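(* Let $t_i=i\Delta t$, $i=0,1,\dots,N$, with $\Delta t=T/N$. Suppose that the threshold $\epsilon_{\mathrm{inc}}$ satisfies $\epsilon_{\mathrm{inc}}\le K_2\Delta t$ for a constant $K_2$, and that the normal component is thresholded at the discrete times, i.e. $$\|N_{u_{\mathbf r}(\mathbf x,t_i)}(G(u_{\mathbf r}(\mathbf x,t_i)))\|\le\epsilon_{\mathrm{inc}}\qquad\text{for all }i=0,1,\dots,N.$$ Then the local truncation error satisfies $$\|E(t_i,t_{i+1})\|\le K_2\Delta t^2+O(\Delta t^2)=O(\Delta t^2),$$ that is, the discrete-time rank-adaptive scheme is consistent with order one in $\Delta t$.
   Context: Let $\Omega=\Omega_1\times\cdots\times\Omega_d\subseteq\mathbb{R}^d$ be compact (a Cartesian product of $d$ real intervals, or a $d$-dimensional flat torus), let $\mu=\prod_{i=1}^d\mu_i$ be a finite product measure on $\Omega$, and let $L^2_\mu(\Omega)$ be the corresponding Hilbert space, with norm $\|\cdot\|$. Consider the initial value problem $\partial u/\partial t=G(u)$, $u(\mathbf x,0)=u_0(\mathbf x)$, on $[0,T]$, where $G$ is a nonlinear operator (which may take into account boundary conditions). Manifold of fixed-rank functional tensor train (FTT) tensors. Let $\mathbf r=(r_0,r_1,\dots,r_d)$ be a vector of positive integers with $r_0=r_d=1$. For an $r_{i-1}\times r_i$ matrix-valued function (core) $\boldsymbol\Psi_i$ of $x_i\in\Omega_i$ with entries in $L^2_{\mu_i}(\Omega_i)$, let $\langle\boldsymbol\Psi_i^{T}\boldsymbol\Psi_i\rangle_i=\int_{\Omega_i}\boldsymbol\Psi_i(x_i)^T\boldsymbol\Psi_i(x_i)\,d\mu_i(x_i)$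 and $\langle\boldsymbol\Psi_i\boldsymbol\Psi_i^{T}\rangle_i=\int_{\Omega_i}\boldsymbol\Psi_i(x_i)\boldsymbol\Psi_i(x_i)^T\,d\mu_i(x_i)$. Let $V^{(i)}_{r_{i-1}\times r_i}$ be the set of such cores for which both matrices are invertible. Define $$\mathcal{M}_{\mathbf r}=\{u_{\mathbf r}\in L^2_\mu(\Omega): u_{\mathbf r}(\mathbf x)=\boldsymbol\Psi_1(x_1)\boldsymbol\Psi_2(x_2)\cdots\boldsymbol\Psi_d(x_d),\ \boldsymbol\Psi_i\in V^{(i)}_{r_{i-1}\times r_i},\ i=1,\dots,d\},$$ which is a smooth Hilbert submanifold of $L^2_\mu(\Omega)$. The tangent space at $u_{\mathbf r}\in\mathcal{M}_{\mathbf r}$ is $T_{u_{\mathbf r}}\mathcal{M}_{\mathbf r}=\{\gamma'(0):\gamma\in C^1((-\delta,\delta),\mathcal{M}_{\mathbf r}),\ \gamma(0)=u_{\mathbf r}\}$, a closed subspace of $L^2_\mu(\Omega)$. $P_{u_{\mathbf r}}$ denotes the orthogonal projection of $L^2_\mu(\Omega)$ onto $T_{u_{\mathbf r}}\mathcal{M}_{\mathbf r}$, and $N_{u_{\mathbf r}}(G(u_{\mathbf r}))=G(u_{\mathbf r})-P_{u_{\mathbf r}}G(u_{\mathbf r})$ is the component of $G(u_{\mathbf r})$ normal to $\mathcal{M}_{\mathbf r}$. Rank-adaptive scheme. The low-rank approximation $u_{\mathbf r}(\mathbf x,t)\in\mathcal{M}_{\mathbf r}$ of $u$ evolves by $\partial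 u_{\mathbf r}/\partial t=P_{u_{\mathbf r}}G(u_{\mathbf r})$, and the rank $\mathbf r$ is increased at time $t_i$ if $\|N_{u_{\mathbf r}(\mathbf x,t_i)}(G(u_{\mathbf r}(\mathbf x,t_i)))\|>\epsilon_{\mathrm{inc}}$. Local truncation error. $E(t_i,t_{i+1})$ is the error at $t_{i+1}$ between $u$ and $u_{\mathbf r}$ after one time step from $t_i$, where $u(\mathbf x,t_i)\in\mathcal{M}_{\mathbf r}$ and $u_{\mathbf r}(\mathbf x,t_i)=u(\mathbf x,t_i)$: $$E(t_i,t_{i+1})=\int_{t_i}^{t_{i+1}}\left[G(u(\mathbf x,\tau))-P_{u_{\mathbf r}(\mathbf x,\tau)}G(u_{\mathbf r}(\mathbf x,\tau))\right]d\tau .$$ For small $\Delta t$ this integral is approximated by the left endpoint, giving $E(t_i,t_{i+1})=\Delta t\,N_{u_{\mathbf r}(\mathbf x,t_i)}(G(u_{\mathbf r}(\mathbf x,t_i)))+O(\Delta t^2)$; this equality is the form of the local truncation error used for the result. *)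

(* Defs.v *)
From HB Require Import structures.
From mathcomp Require Import all_boot all_order all_algebra.
From mathcomp Require Import all_classical all_reals all_analysis.
From mathcomp Require Import measurable_realfun.

Set Implicit Arguments.
Unset Strict Implicit.
Unset Printing Implicit Defensive.

Import Order.TTheory GRing.Theory Num.Theory.
Import numFieldNormedType.Exports.

Local Open Scope classical_set_scope.
Local Open Scope ring_scope.

Section L2.
Context d (T : measurableType d) (R : realType).
Variable mu : {measure set T -> \bar R}.

(* The Hilbert space L^2_mu: the square-integrable functions modulo equality
   mu-almost everywhere, as a normed module. *)
Definition L2 : Type := LspaceType2 mu.

HB.instance Definition _ := gen_eqMixin L2.
HB.instance Definition _ := gen_choiceMixin L2.

Definition L2fun (f : L2) : T -> R := (f : {mfun_ mu, T >-> measurableTypeR R}).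
Coercion L2fun : L2 >-> Funclass.

Implicit Types f g h : L2.

Lemma eq_L2 f g : L2fun f = L2fun g %[ae mu] -> f = g.
Proof.
move=> /= fg.
have : (f : {mfun_ mu, T >-> measurableTypeR R}) = g.
  rewrite -[LHS]reprK -[RHS]reprK; apply/eqquotP; exact/asboolP.
case: f g {fg} => f [[f2]] [g [[g2]]] /= fg; subst g.
by rewrite (Prop_irrelevance f2 g2).
Qed.

Lemma measurable_L2 f : measurable_fun setT (L2fun f).
Proof.
exact: (@measurable_funPT _ _ _ _
          (repr (f : {mfun_ mu, T >-> measurableTypeR R}))).
Qed.

Lemma L2_Lfun f : L2fun f \in Lfun mu 2%:E.
Proof.
apply/andP; split; rewrite inE/=; first exact: measurable_L2.
exact: Lebesgue_finite.
Qed.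

Lemma ae_eq_Lnorm2 (f g : T -> R) : measurable_fun setT f ->
  measurable_fun setT g -> f = g %[ae mu] ->
  'N[mu]_2%:E[EFin \o f]%E = 'N[mu]_2%:E[EFin \o g]%E.
Proof.
move=> mf mg fg; rewrite unlock; congr (_ `^ _)%E.
have mh (h : T -> R) : measurable_fun setT h ->
    measurable_fun setT (fun x => `|(EFin \o h) x| `^ 2)%E.
  move=> mh; apply: (measurableT_comp (measurable_poweR _)).
  by apply: measurableT_comp => //; exact/measurable_EFinP.
apply: ge0_ae_eq_integral => //; [exact: mh|exact: mh| | |
  by apply: filterS fg => x /= fgx xT; rewrite (fgx xT)].
- by move=> x _; exact: poweR_ge0.
- by move=> x _; exact: poweR_ge0.
Qed.

Section L2class.
Variables (f : T -> R) (f2 : f \in Lfun mu 2%:E).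

Let fm : measurable_fun [set: T] (f : T -> measurableTypeR R).
Proof. by case/andP: f2 => /[!inE]. Qed.

Let F : {mfun T >-> measurableTypeR R} :=
  HB.pack f (isMeasurableFun.Build _ _ T (measurableTypeR R) f fm).
Let q : {mfun_ mu, T >-> measurableTypeR R} :=
  \pi_({mfun_ mu, T >-> measurableTypeR R})%qT F.

Let qE : (repr q : T -> R) = f %[ae mu].
Proof.
have /eqmodP/asboolP :
    (repr q = F %[mod {mfun_ mu, T >-> measurableTypeR R}])%qT.
  by rewrite reprK.
exact.
Qed.

Let q2 : finite_norm mu 2%:E q.
Proof.
move: f2 => /andP[/[!inE]/= mf ff]; rewrite /finite_norm.
rewrite (@ae_eq_Lnorm2 _ f)//.
exact: (@measurable_funPT _ _ _ _ (repr q)).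
Qed.

HB.instance Definition _ := isFinLebesgue.Build d T R mu 2%:E (lee1n 2) q q2.

Definition L2class : L2 := [the LspaceType2 mu of q].

Lemma L2classE : L2fun L2class = f %[ae mu].
Proof. exact: qE. Qed.
End L2class.

Let lin2 := Lfun_submod_closed mu (lee1n 2).

Let zero_Lfun : cst 0 \in Lfun mu 2%:E.
Proof. exact: lin2.1. Qed.

Let scale_Lfun a f : (fun x => a * f x) \in Lfun mu 2%:E.
Proof.
have -> : (fun x => a * f x) = (fun x => a * f x + 0).
  by apply/funext => x; rewrite addr0.
exact: (lin2.2 a _ _ (L2_Lfun f) zero_Lfun).
Qed.

Let add_Lfun f g : (fun x => f x + g x) \in Lfun mu 2%:E.
Proof.
have -> : (fun x => f x + g x) = (fun x => 1 * f x + g x).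
  by apply/funext => x; rewrite mul1r.
exact: (lin2.2 1 _ _ (L2_Lfun f) (L2_Lfun g)).
Qed.

Let opp_Lfun f : (fun x => - f x) \in Lfun mu 2%:E.
Proof.
have -> : (fun x => - f x) = (fun x => -1 * f x).
  by apply/funext => x; rewrite mulN1r.
exact: scale_Lfun.
Qed.

Definition L2zero : L2 := L2class zero_Lfun.
Definition L2add f g : L2 := L2class (add_Lfun f g).
Definition L2opp f : L2 := L2class (opp_Lfun f).
Definition L2scale a f : L2 := L2class (scale_Lfun a f).
Definition L2norm f : R := fine 'N[mu]_2%:E[EFin \o L2fun f]%E.
Definition L2inner f g : R := \int[mu]_x (f x * g x).

Lemma ae_L2zero : L2fun L2zero = (fun=> 0) %[ae mu].
Proof. exact: L2classE. Qed.
Lemma ae_L2add f g : L2fun (L2add f g) = (fun x => f x + g x) %[ae mu].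
Proof. exact: L2classE. Qed.
Lemma ae_L2opp f : L2fun (L2opp f) = (fun x => - f x) %[ae mu].
Proof. exact: L2classE. Qed.
Lemma ae_L2scale a f : L2fun (L2scale a f) = (fun x => a * f x) %[ae mu].
Proof. exact: L2classE. Qed.

Let addA : associative L2add.
Proof.
move=> f g h; apply: eq_L2.
move: (ae_L2add f (L2add g h)); apply: filter_app.
move: (ae_L2add g h); apply: filter_app.
move: (ae_L2add (L2add f g) h); apply: filter_app.
move: (ae_L2add f g); apply: filter_app.
apply: aeW => x /= e4 e3 e2 e1 _.
by rewrite (e1 I) (e2 I) (e3 I) (e4 I) addrA.
Qed.

Let addC : commutative L2add.
Proof.
move=> f g; apply: eq_L2.
move: (ae_L2add f g); apply: filter_app.
move: (ae_L2add g f); apply: filter_app.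
apply: aeW => x /= e2 e1 _.
by rewrite (e1 I) (e2 I) addrC.
Qed.

Let add0 : left_id L2zero L2add.
Proof.
move=> f; apply: eq_L2.
move: (ae_L2add L2zero f); apply: filter_app.
move: (ae_L2zero); apply: filter_app.
apply: aeW => x /= e2 e1 _.
by rewrite (e1 I) (e2 I) add0r.
Qed.

Let addN : left_inverse L2zero L2opp L2add.
Proof.
move=> f; apply: eq_L2.
move: (ae_L2add (L2opp f) f); apply: filter_app.
move: (ae_L2opp f); apply: filter_app.
move: (ae_L2zero); apply: filter_app.
apply: aeW => x /= e3 e2 e1 _.
by rewrite (e1 I) (e2 I) (e3 I) addNr.
Qed.

HB.instance Definition _ := GRing.isZmodule.Build L2 addA addC add0 addN.

Let scaleA a b f : L2scale a (L2scale b f) = L2scale (a * b) f.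
Proof.
apply: eq_L2.
move: (ae_L2scale a (L2scale b f)); apply: filter_app.
move: (ae_L2scale b f); apply: filter_app.
move: (ae_L2scale (a * b) f); apply: filter_app.
apply: aeW => x /= e3 e2 e1 _.
by rewrite (e1 I) (e2 I) (e3 I) mulrA.
Qed.

Let scale1 : left_id 1 L2scale.
Proof.
move=> f; apply: eq_L2.
move: (ae_L2scale 1 f); apply: filter_app.
apply: aeW => x /= e1 _.
by rewrite (e1 I) mul1r.
Qed.

Let scaleDr : right_distributive L2scale L2add.
Proof.
move=> a f g; apply: eq_L2.
move: (ae_L2scale a (L2add f g)); apply: filter_app.
move: (ae_L2add f g); apply: filter_app.
move: (ae_L2scale a f); apply: filter_app.
move: (ae_L2scale a g); apply: filter_app.
move: (ae_L2add (L2scale a f) (L2scale a g)); apply: filter_app.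
apply: aeW => x /= e5 e4 e3 e2 e1 _.
by rewrite (e1 I) (e2 I) (e5 I) (e3 I) (e4 I) mulrDr.
Qed.

Let scaleDl f : {morph L2scale^~ f : a b / a + b >-> L2add a b}.
Proof.
move=> a b; apply: eq_L2.
move: (ae_L2scale (a + b) f); apply: filter_app.
move: (ae_L2scale a f); apply: filter_app.
move: (ae_L2scale b f); apply: filter_app.
move: (ae_L2add (L2scale a f) (L2scale b f)); apply: filter_app.
apply: aeW => x /= e4 e3 e2 e1 _.
by rewrite (e1 I) (e4 I) (e2 I) (e3 I) mulrDl.
Qed.

HB.instance Definition _ :=
  GRing.Zmodule_isLmodule.Build R L2 scaleA scale1 scaleDr scaleDl.

Lemma L2normE f : (L2norm f)%:E = 'N[mu]_2%:E[EFin \o L2fun f]%E.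
Proof. exact: (finite_norm_fine (Lfun_Sub (lee1n 2) (L2_Lfun f))). Qed.

Let normD f g : L2norm (f + g) <= L2norm f + L2norm g.
Proof.
rewrite -lee_fin EFinD !L2normE.
rewrite (@ae_eq_Lnorm2 _ (L2fun f \+ L2fun g)); first last.
- exact: ae_L2add.
- by apply: measurable_funD; exact: measurable_L2.
- exact: measurable_L2.
apply: minkowski; [exact: measurable_L2|exact: measurable_L2|exact: (lee1n 2)].
Qed.

Let normZ a f : L2norm (a *: f) = `|a| * L2norm f.
Proof.
apply/EFin_inj; rewrite EFinM !L2normE.
rewrite (@ae_eq_Lnorm2 _ (fun x => a * f x)); first last.
- exact: ae_L2scale.
- apply: measurable_funM; first exact: measurable_cst.
  exact: measurable_L2.
- exact: measurable_L2.
exact: (LnormZ (Lfun_Sub (lee1n 2) (L2_Lfun f))).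
Qed.

Let norm_eq0 f : L2norm f = 0 -> f = 0.
Proof.
move=> f0; apply: eq_L2.
have /= := @fine_Lnormr_eq0 _ _ _ mu _ (lee1n 2)
  (Lfun_Sub (lee1n 2) (L2_Lfun f)) f0.
move=> fae.
move: (fae); apply: filter_app.
move: (ae_L2zero); apply: filter_app.
apply: aeW => x /= e2 e1 _.
by rewrite (e1 I) (e2 I).
Qed.

HB.instance Definition _ := Lmodule_isNormed.Build R L2 normD normZ norm_eq0.

Lemma sqr_L2norm f : `|f| ^+ 2 = L2inner f f.
Proof.
apply/EFin_inj; rewrite -[`|f|]/(L2norm f) -powR_mulrn; last first.
  by rewrite fine_ge0// Lnorm_ge0.
rewrite -poweR_EFin L2normE powR_Lnorm//.
rewrite (eq_integral (fun x => (f x * f x)%:E)); last first.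
  by move=> x _ /=; rewrite powR_mulrn// real_normK ?num_real// expr2.
rewrite /L2inner /Rintegral fineK//.
by apply: integrable_fin_num => //; exact: (Lfun2_integrable_sqr (L2_Lfun f)).
Qed.

End L2.

(* Integral of an L^2-valued function over [a, b], in the weak sense. It agrees
   with the Bochner integral whenever the latter exists. *)
Definition is_L2integral d (T : measurableType d) (R : realType)
    (mu : {measure set T -> \bar R}) (f : R -> L2 mu) (a b : R) (e : L2 mu) :=
  forall v : L2 mu,
    lebesgue_measure.-integrable `[a, b] (fun t => (L2inner (f t) v)%:E) /\
    L2inner e v = \int[lebesgue_measure]_(t in `[a, b]) L2inner (f t) v.

(* Orthogonal projection of w onto S; the element returned is characterized by
   the defining property as soon as S is a closed subspace. *)
Definition orth_proj d (T : measurableType d) (R : realType)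
    (mu : {measure set T -> \bar R}) (S : set (L2 mu)) (w : L2 mu) : L2 mu :=
  xget 0 [set p | S p /\ forall s, S s -> L2inner (w - p) s = 0].

Definition C1_curve (R : realType) (V : normedModType R) (delta : R)
    (M : set V) (gamma : R -> V) :=
  forall t, t \in `]- delta, delta[ ->
    [/\ M (gamma t), derivable gamma t 1 & {for t, continuous (derive1 gamma)}].

Definition tangent_space (R : realType) (V : normedModType R)
    (M : set V) (v : V) : set V :=
  [set w | exists delta : R, 0 < delta /\
     exists gamma : R -> V,
       [/\ C1_curve delta M gamma, gamma 0 = v & derive1 gamma 0 = w]].

(* At t = a and t = b the derivative is the one-sided one. *)
Definition solves_on (R : realType) (V : normedModType R)
    (F : V -> V) (a b : R) (u : R -> V) :=
  forall t, t \in `[a, b] ->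
    (s - t)^-1 *: (u s - u t) @[s --> within `[a, b] t^'] --> F (u t).

Definition compact_box (R : realType) d (Omega : 'I_d -> set R) :=
  forall i, exists a b : R, a <= b /\ Omega i = `[a, b]%classic.

(* The circle R / L Z is represented by the fundamental domain [0, L[, with
   which it shares its Borel sets, hence its finite measures. *)
Definition flat_torus (R : realType) d (Omega : 'I_d -> set R) :=
  forall i, exists L : R, 0 < L /\ Omega i = `[0, L[%classic.

(* A finite measure on Omega_i is a finite Borel measure on R that vanishes
   outside Omega_i; the product identity below then determines mu, whose L^2
   space is that of Omega_1 x .. x Omega_d. *)
Definition product_measure (R : realType) d
    (mui : 'I_d -> {finite_measure set R -> \bar R})
    (mu : {measure set (d.-tuple R) -> \bar R}) :=
  forall A : 'I_d -> set R, (forall i, measurable (A i)) ->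
    mu [set x | forall i, A i (tnth x i)] = (\prod_(i < d) mui i (A i))%E.

Record rank_vector (d : nat) := RankVector {
  rk :> nat -> nat;
  rk_gt0 : forall i, (i <= d)%N -> (0 < rk i)%N;
  rk_first : rk 0 = 1%N;
  rk_last : rk d = 1%N }.

Section FTT.
Variables (R : realType) (d : nat).
Variables (mui : 'I_d -> {finite_measure set R -> \bar R}).
Variables (mu : {measure set (d.-tuple R) -> \bar R}).

Definition L2_core m n (nu : {measure set R -> \bar R})
    (Psi : R -> 'M[R]_(m, n)) :=
  [/\ forall a b, (fun x => Psi x a b) \in Lfun nu 2%:E,
      (\matrix_(a, b) \int[nu]_x ((Psi x)^T *m Psi x) a b) \in unitmx &
      (\matrix_(a, b) \int[nu]_x (Psi x *m (Psi x)^T) a b) \in unitmx].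

(* Variables are numbered from 0: the core of variable i has size
   r i x r i.+1. *)
Fixpoint core_prod (r : nat -> nat)
    (Psi : forall i, R -> 'M[R]_(r i, r i.+1)) (n : nat) (x : seq R) :
    'M[R]_(r 0, r n) :=
  if n is m.+1 then core_prod Psi m x *m Psi m (nth 0 x m) else 1%:M.

Definition ftt (r : rank_vector d) (Psi : forall i, R -> 'M[R]_(r i, r i.+1))
    (x : d.-tuple R) : R :=
  castmx (rk_first r, rk_last r) (core_prod Psi d x) ord0 ord0.

Definition ftt_manifold (r : rank_vector d) : set (L2 mu) :=
  [set u | exists Psi : forall i, R -> 'M[R]_(r i, r i.+1),
     (forall i : 'I_d, L2_core (mui i) (Psi i)) /\
     L2fun u = ftt Psi %[ae mu]].

Definition tangent_proj (r : rank_vector d) (v w : L2 mu) : L2 mu :=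
  orth_proj (tangent_space (ftt_manifold r) v) w.

Definition tangent_part (r : rank_vector d) (G : L2 mu -> L2 mu) (v : L2 mu) :
    L2 mu :=
  tangent_proj r v (G v).

Definition normal_part (r : rank_vector d) (G : L2 mu -> L2 mu) (v : L2 mu) :
    L2 mu :=
  G v - tangent_proj r v (G v).

End FTT.

Definition dt (R : realType) (T : R) (N : nat) : R := T / N%:R.

Definition grid (R : realType) (T : R) (N i : nat) : R := i%:R * dt T N.

(* For a family f N i attached to the i-th step of the scheme with N steps, the
   worst case over the N steps; bounds on it are uniform in i. *)
Definition step_max (R : realType) (V : normedModType R) (f : nat -> nat -> V)
    (N : nat) : R :=
  \big[Num.max/0]_(i < N) `|f N i|.

Definition consistent_of_order (R : realType) (V : normedModType R) (p : nat)
    (T : R) (E : nat -> nat -> V) :=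
  step_max E =O_\oo (fun N => dt T N ^+ p.+1).

(* Main.v *)
Require Import Defs.
From HB Require Import structures.
From mathcomp Require Import all_boot all_order all_algebra.
From mathcomp Require Import all_classical all_reals all_analysis.
From mathcomp Require Import measurable_realfun.

Set Implicit Arguments.
Unset Strict Implicit.
Unset Printing Implicit Defensive.

Import Order.TTheory GRing.Theory Num.Theory.
Import numFieldNormedType.Exports.

Local Open Scope classical_set_scope.
Local Open Scope ring_scope.

(** The left-endpoint rule [hquad] splits each one-step error into [dt] times the normal component
    at the start of the step, plus a remainder that is of second order uniformly in the step.
    Thresholding bounds the normal component by [eps_inc N <= K2 * dt T N], so one factor [dt] comes
    from the length of the step and the other from the threshold. The triangle inequality gives the
    explicit bound, and [consistent_of_order_bound] turns it into an order statement. *)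

Section StepMax.
Variables (R : realType) (V : normedModType R).
Implicit Types f g : nat -> nat -> V.

Lemma le_step_max f N i : (i < N)%N -> `|f N i| <= step_max f N.
Proof.
move=> iN; rewrite /step_max.
exact: (le_bigmax 0 (fun j : 'I_N => `|f N j|) (Ordinal iN)).
Qed.

Lemma step_max_le f N c :
  0 <= c -> (forall i, (i < N)%N -> `|f N i| <= c) -> step_max f N <= c.
Proof. by move=> c0 fc; apply: bigmax_le => // i _; exact: fc. Qed.

Lemma step_max_ge0 f N : 0 <= step_max f N.
Proof. exact: bigmax_ge_id. Qed.

End StepMax.

(** Since [h] does not depend on [i], the pointwise bound passes to the maximum over the steps, and
    the two second-hand constants merge into one. *)
Lemma consistent_of_order_bound (R : realType) (V : normedModType R) (p : nat)
    (T K : R) (h : nat -> R) (E : nat -> nat -> V) :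
  h =O_\oo (fun N => dt T N ^+ p.+1) ->
  (forall N i, (i < N)%N -> `|E N i| <= K * dt T N ^+ p.+1 + h N) ->
  consistent_of_order p T E.
Proof.
move=> /eqO_exP[C C0 hC] EKh; apply/eqO_exP.
(* [K] may be negative, hence its absolute value; [C] is positive and makes the sum so. *)
exists (`|K| + C); first by rewrite ltr_wpDl.
apply: filterS hC => N hN; rewrite ger0_norm ?step_max_ge0//.
apply: step_max_le => [|i iN]; first by rewrite mulr_ge0// addr_ge0// ltW.
apply: (le_trans (EKh N i iN)); rewrite mulrDl lerD//.
  by rewrite -normrM ler_norm.
exact: le_trans (ler_norm _) hN.
Qed.

Theorem mainTheorem3 (R : realType) (d : nat)
  (Omega : 'I_d -> set R) (hOmega : compact_box Omega \/ flat_torus Omega)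
  (mui : 'I_d -> {finite_measure set R -> \bar R})
  (hmui : forall i, mui i (~` Omega i) = 0%E)
  (mu : {measure set (d.-tuple R) -> \bar R}) (hmu : product_measure mui mu)
  (G : L2 mu -> L2 mu) (T : R) (hT : 0 < T) (u0 : L2 mu)
  (u : R -> L2 mu) (hu : solves_on G 0 T u) (hu0 : u 0 = u0)
  (r : nat -> nat -> rank_vector d)
  (ur : nat -> nat -> R -> L2 mu)
  (hstart : forall N i, (0 < N)%N -> (i <= N)%N ->
     ftt_manifold mui (r N i) (u (grid T N i)) /\
     ur N i (grid T N i) = u (grid T N i))
  (hur : forall N i, (i < N)%N ->
     (forall t, t \in `[grid T N i, grid T N i.+1] ->
        ftt_manifold mui (r N i) (ur N i t)) /\
     solves_on (tangent_part mui (r N i) G)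
       (grid T N i) (grid T N i.+1) (ur N i))
  (E : nat -> nat -> L2 mu)
  (hE : forall N i, (i < N)%N ->
     is_L2integral
       (fun t => G (u t) - tangent_part mui (r N i) G (ur N i t))
       (grid T N i) (grid T N i.+1) (E N i))
  (hquad : step_max (fun N i =>
       E N i - dt T N *: normal_part mui (r N i) G (ur N i (grid T N i)))
     =O_\oo (fun N => dt T N ^+ 2))
  (K2 : R) (eps_inc : nat -> R)
  (heps : forall N, (0 < N)%N -> eps_inc N <= K2 * dt T N)
  (hthreshold : forall N i, (0 < N)%N -> (i <= N)%N ->
     `|normal_part mui (r N i) G (ur N i (grid T N i))| <= eps_inc N) :
  (exists h : nat -> R, h =O_\oo (fun N => dt T N ^+ 2) /\
     forall N i, (i < N)%N -> `|E N i| <= K2 * dt T N ^+ 2 + h N) /\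
  consistent_of_order 1 T E.
Proof.
(* [Q] is the quadrature remainder; its worst case [step_max Q] serves as the witness [h]. *)
set Q := fun N i => E N i - _ in hquad.
have EKh N i : (i < N)%N -> `|E N i| <= K2 * dt T N ^+ 2 + step_max Q N.
  move=> iN; have N0 : (0 < N)%N by exact: leq_ltn_trans iN.
  have dt0 : 0 <= dt T N by rewrite divr_ge0// ltW.
  rewrite -(subrK (dt T N *: normal_part mui (r N i) G (ur N i (grid T N i)))
    (E N i)) addrC.
  apply: (le_trans (ler_normD _ _)); rewrite lerD//; last exact: (le_step_max Q).
  (* Writing [K2 * dt ^+ 2] as [dt * (K2 * dt)] and cancelling one [dt] leaves the threshold bound
     at the left endpoint. *)
  rewrite normrZ ger0_norm// expr2 mulrCA ler_wpM2l//.
  exact: le_trans (hthreshold N i N0 (ltnW iN)) (heps N N0).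
split; first by exists (step_max Q).
exact: consistent_of_order_bound hquad EKh.
Qed.
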